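(* Let $\mathbb{K}$ be an algebraically closed field of characteristic zero and let $k$ be a nonnegative integer. There exists a form $F\in\mathbb{K}[x,y,z]$ of degree $2k+2$ with $\operatorname{rk} F>k^2+3k+2$.
   Context: A form is a homogeneous polynomial. The (Waring) rank $\operatorname{rk} F$ of a form $F\in\mathbb{K}[x,y,z]$ of degree $d$ is the least number $r$ such that $F$ can be written as a sum $F=\ell_1^d+\cdots+\ell_r^d$ of $d$-th powers of linear forms $\ell_1,\ldots,\ell_r\in\mathbb{K}[x,y,z]$ (homogeneous polynomials of degree one). *)

(* Defs.v *)
From mathcomp Require Import all_boot all_order all_algebra.
From mathcomp Require Import mpoly.

Set Implicit Arguments.
Unset Strict Implicit.
Unset Printing Implicit Defensive.

Import GRing.Theory.
Local Open Scope ring_scope.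

Definition has_waring_decomp (K : fieldType) (n d : nat)
    (F : {mpoly K[n]}) (r : nat) : Prop :=
  exists l : 'I_r -> {mpoly K[n]},
    (forall i, l i \is 1.-homog) /\ F = \sum_(i < r) l i ^+ d.

(* The degree d is explicit because the zero polynomial is homogeneous of every
   degree.  The relation includes the existence of a decomposition of length r,
   so it never holds vacuously. *)
Definition is_waring_rank (K : fieldType) (n d : nat)
    (F : {mpoly K[n]}) (r : nat) : Prop :=
  has_waring_decomp d F r /\
  forall s : nat, has_waring_decomp d F s -> (r <= s)%N.

(* Main.v *)
Require Import Defs.
From mathcomp Require Import all_boot all_order all_algebra.
From mathcomp Require Import cyclic separable cyclotomic.
From mathcomp Require Import mpoly zify ring.

(** The form F = x y^k z^(k+1) + y^(2k+2) has rank exactly (k+1)(k+2) + 1.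

    Upper bound: filtering (x + e y + f z)^(2k+2) over the (k+1)-st roots of
    unity e and the (k+2)-nd roots of unity f isolates x y^k z^(k+1).

    Lower bound: comparing the coefficients of F with those of a sum of powers
    of a_i x + b_i y + c_i z gives the moments sum_i a_i^(d-p-q) b_i^p c_i^q.
    A Hankel matrix of these moments factors through the set of indices with
    a_i != 0, while it contains a triangular block with nonzero diagonal, of
    size (k+1)(k+2) in general and one more if every a_i is nonzero. *)

Set Implicit Arguments.
Unset Strict Implicit.
Unset Printing Implicit Defensive.

Import GRing.Theory.
Local Open Scope ring_scope.

(** * Size bound for a triangular matrix given as a product *)

(** If [#|T| > #|J|], the rows of [X] satisfy a nontrivial relation [C], which also kills the
    product matrix. But in the column of an index [v] of maximal [deg] in the support of [C], only
    the nonzero diagonal term survives. *)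
Lemma triangular_factor_card (K : fieldType) (T I : finType) (J : {set I})
    (deg : T -> nat) (X : T -> I -> K) (Y : I -> T -> K) :
  (forall v, \sum_(i in J) X v i * Y i v != 0) ->
  (forall u v, u != v -> (deg u <= deg v)%N ->
     \sum_(i in J) X u i * Y i v = 0) ->
  (#|T| <= #|J|)%N.
Proof.
move=> Mdiag Mtri; rewrite leqNgt; apply/negP => ltJT.
pose A : 'M[K]_(#|T|, #|J|) := \matrix_(t, j) X (enum_val t) (enum_val j).
have /rowV0Pn[c /sub_kermxP cA c_neq0] : kermx A != 0.
  rewrite kermx_eq0 /row_free neq_ltn.
  by rewrite (leq_ltn_trans (rank_leq_col A) ltJT).
pose C t := c 0 (enum_rank t).
have CX i : i \in J -> \sum_t C t * X t i = 0.
  move=> iJ; move/matrixP/(_ 0 (enum_rank_in iJ i)): cA; rewrite !mxE => cA.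
  rewrite -[RHS]cA (reindex (enum_val : 'I_#|T| -> T)) /=; last first.
    by exists enum_rank => x _; rewrite ?enum_valK ?enum_rankK.
  by apply: eq_bigr => t _; rewrite /C mxE enum_valK enum_rankK_in.
have [t0 Ct0] : exists t, C t != 0.
  case/rV0Pn: c_neq0 => j cj; exists (enum_val j); by rewrite /C enum_valK.
case: (@arg_maxnP _ t0 (fun t => C t != 0) deg Ct0) => v Cv vmax.
have /eqP : \sum_u C u * \sum_(i in J) X u i * Y i v = 0.
  under eq_bigr do rewrite mulr_sumr.
  rewrite exchange_big big1 // => i iJ.
  under eq_bigr do rewrite mulrA.
  by rewrite -mulr_suml CX ?mul0r.
rewrite (bigD1 v) //= [X in _ + X]big1 => [|u uv].
  by rewrite addr0 mulf_eq0 (negbTE Cv) (negbTE (Mdiag v)).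
have [->|Cu] := eqVneq (C u) 0; first by rewrite mul0r.
by rewrite Mtri ?mulr0 //; apply: vmax.
Qed.

(** * Moments and their Hankel matrix *)

Definition moment (K : fieldType) d s (a b c : 'I_s -> K) p q :=
  \sum_i a i ^+ (d - (p + q)) * b i ^+ p * c i ^+ q.

(* The functional [L := sum a_i^d ev(b_i/a_i, c_i/a_i)], over the i with
   [a_i != 0], gives a Hankel form [L (m * m')] on polynomials in y and z. It is
   triangular on the monomials y^i z^j with i <= k and j <= k + 1, tested against their complements y^(k-i) z^(k+1-j). If no [a_i]
   vanishes, the top moments agree with the functional too, and y^(k+1), tested
   against itself, can be added to the list. *)
Lemma moments_card (K : fieldType) k s (a b c : 'I_s -> K) :
  let d := (2 * k + 2)%N in let mom := moment d a b c in
  (forall p q, (p + q <= d)%N ->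
     (p, q) != (k, k.+1) -> (p, q) != (d, 0%N) -> mom p q = 0) ->
  mom k k.+1 != 0 -> mom d 0%N != 0 -> ((k + 1) * (k + 2) < s)%N.
Proof.
move=> d mom mom0 momG momH.
pose J := [set i | a i != 0].
pose X (p q : nat) i := (b i / a i) ^+ p * (c i / a i) ^+ q.
(* On [J] the denominators cancel. Off [J] the factor [a i ^+ (d - _)] is zero below degree [d] but
   is [0 ^+ 0 = 1] in degree [d], hence the alternative [J == setT]. *)
have hankel (p q p' q' : nat) : (p + p' + (q + q') <= d)%N ->
    (p + p' + (q + q') < d)%N || (J == setT) ->
    \sum_(i in J) X p q i * (a i ^+ d * X p' q' i) = mom (p + p')%N (q + q')%N.
  move=> led ltd; rewrite /mom /moment [RHS](bigID (mem J)) /=.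
  rewrite [X in _ + X]big1 ?addr0.
    apply: eq_bigr => i; rewrite inE => ai.
    rewrite -{1}(subnK led) /X !exprD !exprMn !exprVn.
    have an n : a i ^+ n != 0 by rewrite expf_neq0.
    by field; rewrite !an.
  move=> i iJ; case/orP: ltd => [ltd|/eqP JT]; last by rewrite JT inE in iJ.
  move: iJ; rewrite inE negbK => /eqP ->.
  by rewrite expr0n subn_eq0 leqNgt ltd !mul0r.
rewrite ltnNge; apply/negP => les.
pose T0 : finType := ('I_k.+1 * 'I_k.+2)%type.
pose D0 (u : T0) := (u.1 + u.2)%N.
pose X0 (u : T0) i := X u.1 u.2 i.
pose Y0 i (v : T0) := a i ^+ d * X (k - v.1)%N (k.+1 - v.2)%N i.
(* The exponents add up to [2k + 1 + D0 u - D0 v < d], which excludes [(d, 0)]; they equal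
   [(k, k.+1)] only for [u = v]. *)
have H0 u v : (D0 u <= D0 v)%N ->
  \sum_(i in J) X0 u i * Y0 i v = if u == v then mom k k.+1 else 0.
  case: u v => [u1 u2] [v1 v2]; rewrite /D0 /= => uv.
  have := ltn_ord u1; have := ltn_ord u2; have := ltn_ord v1.
  have := ltn_ord v2 => *.
  rewrite hankel /=; [|rewrite /d; lia|apply/orP; left; rewrite /d; lia].
  case: eqP => [[-> ->]|uv1]; first by congr mom; lia.
  apply: mom0; rewrite ?xpair_eqE /d; [lia| |lia].
  apply/negP => /andP[/eqP h1 /eqP h2]; apply: uv1.
  by congr pair; apply/val_inj => /=; lia.
have [JT|JT] := eqVneq J setT; last first.
  have : (#|T0| <= #|J|)%N.
    apply: (@triangular_factor_card K T0 _ J D0 X0 Y0) => [v|u v /negPf uv led].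
      by rewrite H0 // eqxx.
    by rewrite H0 // uv.
  have : (#|J| < s)%N.
    by rewrite -[X in (_ < X)%N]card_ord -cardsT proper_card // properT.
  by rewrite card_prod !card_ord; lia.
(* [None] stands for y^(k+1). Paired with any [Some], it gives a y-exponent strictly between [k] and
   [d], so neither exceptional moment occurs; paired with itself it gives [mom d 0]. *)
have : (#|{: option T0}| <= #|J|)%N.
  apply: (@triangular_factor_card K (option T0) _ J
    (fun u => if u is Some u then D0 u else k.+1)
    (fun u i => if u is Some u then X0 u i else X k.+1 0%N i)
    (fun i v => if v is Some v then Y0 i v else a i ^+ d * X k.+1 0%N i)).
    case=> [v|]; first by rewrite H0 // eqxx.
    rewrite hankel ?JT ?eqxx ?orbT //; last by rewrite /d; lia.
    by have -> : (k.+1 + k.+1 = d)%N by rewrite /d; lia.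
  case=> [u|] [v|] //.
  - by rewrite (inj_eq Some_inj) => /negPf uv led; rewrite H0 // uv.
  - case: u => [u1 u2] _; have := ltn_ord u1; have := ltn_ord u2.
    rewrite /D0 /= => *.
    rewrite hankel ?JT ?eqxx ?orbT // ?mom0 // ?xpair_eqE /d //=; lia.
  - case: v => [v1 v2] _; have := ltn_ord v1; have := ltn_ord v2.
    rewrite /D0 /= => *.
    rewrite hankel ?JT ?eqxx ?orbT // ?mom0 // ?xpair_eqE /d //=; lia.
by rewrite card_option card_prod !card_ord JT cardsT card_ord; lia.
Qed.

(** * Ternary monomials and powers of linear forms *)

Definition mnm3 (p q r : nat) : 'X_{1..3} := [multinom [tuple p; q; r]].

Lemma mnm3_eta (m : 'X_{1..3}) :
  m = mnm3 (m ord0) (m (inord 1)) (m (inord 2)).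
Proof.
apply/mnmP => i; rewrite multinomE (tnth_nth 0%N) /=.
by case: i => [[|[|[|]]]] //= h; congr (m _); apply/val_inj; rewrite /= ?inordK.
Qed.

Lemma eq_mnm3 p q r p' q' r' :
  (mnm3 p q r == mnm3 p' q' r') = [&& p == p', q == q' & r == r'].
Proof. by rewrite -val_eqE /= -val_eqE /= !eqseq_cons andbT. Qed.

Lemma mdeg_mnm3 p q r : mdeg (mnm3 p q r) = (p + q + r)%N.
Proof. by rewrite mdegE !big_ord_recl big_ord0 !multinomE /= addn0 addnA. Qed.

Lemma mpolyX_mnm3 (K : fieldType) p q r :
  'X_[mnm3 p q r] =
  'X_ord0 ^+ p * 'X_(inord 1) ^+ q * 'X_(inord 2) ^+ r :> {mpoly K[3]}.
Proof.
rewrite mpolyXE_id !big_ord_recl big_ord0 mulr1 !multinomE /= mulrA.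
by congr (_ * 'X_ _ ^+ _ * 'X_ _ ^+ _); apply/val_inj; rewrite /= inordK.
Qed.

Definition lin3 (K : fieldType) (a b c : K) : {mpoly K[3]} :=
  a *: 'X_ord0 + (b *: 'X_(inord 1) + c *: 'X_(inord 2)).

Lemma lin3_homog (K : fieldType) (a b c : K) : lin3 a b c \is 1.-homog.
Proof. by do ?apply: rpredD; apply: rpredZ; rewrite dhomogX /= mdeg1. Qed.

Lemma homog1_lin3 (K : fieldType) (l : {mpoly K[3]}) :
  l \is 1.-homog -> exists a b c : K, l = lin3 a b c.
Proof.
move=> hl; exists l@_(mnm3 1 0 0), l@_(mnm3 0 1 0), l@_(mnm3 0 0 1).
have UE : [/\ U_(ord0)%MM = mnm3 1 0 0, U_(inord 1)%MM = mnm3 0 1 0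
            & U_(inord 2)%MM = mnm3 0 0 1].
  by split; apply/mnmP => i; rewrite mnm1E multinomE (tnth_nth 0%N) /=;
     case: i => [[|[|[|]]]] //= h; rewrite -val_eqE /= ?inordK.
case: UE => U0 U1 U2; apply/mpolyP => m; rewrite [m]mnm3_eta.
move: (m ord0) (m (inord 1)) (m (inord 2)) => p q r {m}.
rewrite !mcoeffD !mcoeffZ !mcoeffX U0 U1 U2 !eq_mnm3.
have [/eqP dm|dm] := boolP (mdeg (mnm3 p q r) == 1%N).
  move: dm; rewrite mdeg_mnm3.
  by case: p q r => [|[|p]] [|[|q]] [|[|r]] //= _; ring.
rewrite (dhomog_nemf_coeff hl dm).
move: dm; rewrite mdeg_mnm3.
by case: p q r => [|[|p]] [|[|q]] [|[|r]] //= _; ring.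
Qed.

Lemma scale_mul3 (K : fieldType) (A : comAlgType K) (a b c : K) (x y z : A)
    m n :
  (a *: x) * ((b *: y) * (c *: z) *+ n) *+ m =
  (a * b * c * (m * n)%:R) *: (x * y * z).
Proof.
rewrite -!scaler_nat -!(scalerAl, scalerAr) !scalerA !mulrA natrM.
by congr (_ *: _); ring.
Qed.

(** For [p + q <= d], the multinomial coefficient d!/((d-p-q)! p! q!), in the shape produced by two
    nested binomial expansions. *)
Definition trinom d (p q : nat) := ('C(d, p + q) * 'C(p + q, q))%N.

Lemma trinom_gt0 d p q : (p + q <= d)%N -> (0 < trinom d p q)%N.
Proof. by move=> pqd; rewrite muln_gt0 !bin_gt0 pqd leq_addl. Qed.

Lemma mcoeff_lin3X (K : fieldType) (a b c : K) d p q r :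
  (lin3 a b c ^+ d)@_(mnm3 p q r) =
  if (p + q + r == d)%N
  then (trinom d q r)%:R * (a ^+ p * b ^+ q * c ^+ r) else 0.
Proof.
have E : lin3 a b c ^+ d = \sum_(i < d.+1) \sum_(j < i.+1)
    (a ^+ (d - i) * b ^+ (i - j) * c ^+ j * ('C(d, i) * 'C(i, j))%:R) *:
      'X_[mnm3 (d - i) (i - j) j].
  rewrite /lin3 exprDn; apply: eq_bigr => i _.
  rewrite exprDn mulr_sumr -sumrMnl; apply: eq_bigr => j _.
  by rewrite !exprZn mpolyX_mnm3 scale_mul3.
have C i j : (j <= i)%N ->
    ((a ^+ (d - i) * b ^+ (i - j) * c ^+ j * ('C(d, i) * 'C(i, j))%:R) *:
      'X_[mnm3 (d - i) (i - j) j])@_(mnm3 p q r) =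
    if [&& d - i == p, i - j == q & j == r]%N
    then (trinom d q r)%:R * (a ^+ p * b ^+ q * c ^+ r) else 0.
  move=> ji; rewrite mcoeffZ mcoeffX eq_mnm3.
  case: ifP => [/and3P[/eqP <- /eqP <- /eqP <-]|_].
    by rewrite /trinom subnK // mulr1 mulrC.
  by rewrite mulr0.
rewrite E (raddf_sum (mcoeff _)) /=.
under eq_bigr => i _.
  rewrite (raddf_sum (mcoeff _)) /=.
  under eq_bigr => j _ do rewrite C -1?ltnS //.
  over.
case: eqP => [dE|dN].
  (* Only the term [i = q + r], [j = r] carries the monomial x^p y^q z^r. *)
  have hi : (q + r < d.+1)%N by lia.
  have hj : (r < (q + r).+1)%N by lia.
  rewrite (bigD1 (Ordinal hi)) //= (bigD1 (Ordinal hj)) //= ifT; last by lia.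
  rewrite !big1 ?addr0 // => [i|j].
    rewrite -val_eqE /= => ni; rewrite big1 // => j _; rewrite ifF //.
    by have := ltn_ord i; have := ltn_ord j; lia.
  by rewrite -val_eqE /= => nj; rewrite ifF //; lia.
rewrite big1 // => i _; rewrite big1 // => j _; rewrite ifF //.
by have := ltn_ord i; have := ltn_ord j; lia.
Qed.

(** * Roots of unity and weighted sums of powers *)

(** X^n - 1 splits and is separable, so there are [n] distinct n-th roots of unity, and one of them
    is primitive. *)
Lemma prim_root_exists (K : closedFieldType) n :
  n%:R != 0 :> K -> exists z : K, n.-primitive_root z.
Proof.
move=> nK; have n_gt0 : (0 < n)%N by case: n nK => //; rewrite eqxx.
have [zs] := closed_field_poly_normal ('X^n - 1 : {poly K}).
rewrite (monicP (monicXnsubC 1 n_gt0)) scale1r => zsE.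
suff /hasP[z _ zn] : has n.-primitive_root zs by exists z.
apply: has_prim_root => //.
- apply/allP => z zzs; rewrite unity_rootE -subr_eq0.
  by have := root_prod_XsubC zs z; rewrite -zsE zzs /root !hornerE.
- by rewrite -separable_prod_XsubC -zsE; apply: separable_Xn_sub_1.
by have := size_prod_XsubC zs id; rewrite -zsE size_XnsubC // => -[->].
Qed.

Lemma sum_prim_rootX (K : fieldType) n (z : K) m : n.-primitive_root z ->
  \sum_(i < n) (z ^+ i) ^+ m = if (n %| m)%N then n%:R else 0.
Proof.
move=> zn; under eq_bigr do rewrite exprAC.
rewrite (prim_order_dvd zn); have [->|zm] := eqVneq (z ^+ m) 1.
  by under eq_bigr do rewrite expr1n; rewrite sumr_const card_ord.
apply: (mulfI (x := z ^+ m - 1)); first by rewrite subr_eq0.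
by rewrite -subrX1 exprAC (prim_expr_order zn) expr1n subrr mulr0.
Qed.

(** Each weight has a d-th root, which is absorbed into its linear form. *)
Lemma weighted_waring_decomp (K : closedFieldType) n d (T : finType)
    (w : T -> K) (l : T -> {mpoly K[n]}) : (0 < d)%N ->
  (forall t, l t \is 1.-homog) ->
  has_waring_decomp d (\sum_t w t *: l t ^+ d) #|T|.
Proof.
move=> d_gt0 hl.
have root t : exists x, x ^+ d == w t.
  have [x xd] :=
    @solve_monicpoly K d (fun i => if i == 0%N then w t else 0) d_gt0.
  exists x; rewrite xd; case: (d) d_gt0 => // d' _.
  rewrite big_ord_recl big1 /= ?addr0 ?mulr1 // => i _.
  by rewrite mul0r.
exists (fun i => xchoose (root (enum_val i)) *: l (enum_val i)).
split=> [i|]; first exact/rpredZ/hl.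
rewrite (reindex (enum_val : 'I_#|T| -> T)) /=; last first.
  by exists enum_rank => x _; rewrite ?enum_valK ?enum_rankK.
by apply: eq_bigr => i _; rewrite exprZn (eqP (xchooseP (root (enum_val i)))).
Qed.

(** * The form and its two rank bounds *)

Definition high_rank_form (K : fieldType) (k : nat) : {mpoly K[3]} :=
  'X_[mnm3 1 k k.+1] + 'X_[mnm3 0 (2 * k + 2) 0].

Lemma high_rank_form_homog (K : fieldType) k :
  high_rank_form K k \is (2 * k + 2).-homog.
Proof. by apply: rpredD; rewrite dhomogX /= mdeg_mnm3; apply/eqP; lia. Qed.

(** In characteristic zero the multinomial factors are nonzero, so a moment vanishes exactly when
    the matching coefficient of the form does. *)
Lemma waring_decomp_high_rank_form_ge (K : fieldType) k s :
  [pchar K] =i pred0 ->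
  has_waring_decomp (2 * k + 2) (high_rank_form K k) s ->
  ((k + 1) * (k + 2) < s)%N.
Proof.
move=> /pcharf0P charK0 [l [hl FE]].
have /fin_all_exists[a /fin_all_exists[b /fin_all_exists[c lE]]] i :=
  homog1_lin3 (hl i).
set d := (2 * k + 2)%N in FE *.
have coefE p q : (p + q <= d)%N ->
    (trinom d p q)%:R * moment d a b c p q =
    ((p, q) == (k, k.+1))%:R + ((p, q) == (d, 0%N))%:R.
  move=> pqd; rewrite !xpair_eqE.
  have := congr1 (mcoeff (mnm3 (d - (p + q)) p q)) FE.
  rewrite mcoeffD !mcoeffX !eq_mnm3 (raddf_sum (mcoeff _)) /=.
  have dE : (d - (p + q) + p + q = d)%N by lia.
  under eq_bigr do rewrite lE mcoeff_lin3X dE eqxx.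
  rewrite /moment mulr_sumr => <-.
  by congr (_%:R + _%:R); move: pqd; rewrite /d; lia.
have trinom_neq0 p q : (p + q <= d)%N -> (trinom d p q)%:R != 0 :> K.
  by move=> /trinom_gt0; rewrite charK0 lt0n.
apply: (@moments_card K k s a b c) => [p q pqd /negPf Ng /negPf Nh||].
- have /eqP := coefE _ _ pqd; rewrite Ng Nh addr0 mulf_eq0.
  by rewrite (negPf (trinom_neq0 _ _ pqd)) => /eqP.
- have pqd : (k + k.+1 <= d)%N by rewrite /d; lia.
  apply/eqP => m0; have := coefE _ _ pqd; rewrite m0 mulr0 eqxx xpair_eqE andbF.
  by move/eqP; rewrite addr0 eq_sym oner_eq0.
have pqd : (d + 0 <= d)%N by rewrite addn0.
apply/eqP => m0; have := coefE _ _ pqd; rewrite m0 mulr0 eqxx xpair_eqE andbF.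
by move/eqP; rewrite add0r eq_sym oner_eq0.
Qed.

Lemma waring_decomp_high_rank_form (K : closedFieldType) k :
  [pchar K] =i pred0 ->
  has_waring_decomp (2 * k + 2) (high_rank_form K k) ((k + 1) * (k + 2)).+1.
Proof.
move=> /pcharf0P charK0; set d := (2 * k + 2)%N.
have [e pe] : exists e : K, k.+1.-primitive_root e.
  by apply: prim_root_exists; rewrite charK0.
have [f pf] : exists f : K, k.+2.-primitive_root f.
  by apply: prim_root_exists; rewrite charK0.
pose T : finType := ('I_k.+1 * 'I_k.+2)%type.
(* Coefficient with which x y^k z^(k+1) leaves the unnormalised filter. *)
pose N : K := (trinom d k k.+1)%:R * k.+1%:R * k.+2%:R.
have N_neq0 : N != 0.
  by rewrite !mulf_neq0 // charK0 // -lt0n trinom_gt0 // /d; lia.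
(* For k = 0 the filter on the exponent of y is vacuous and would let y z pass;
   y is then dropped from the linear forms. *)
pose y0 : K := (k != 0)%N%:R.
(* These weights shift exponents by one: the filter keeps y^q z^r when [k.+1 %| q.+1] and
   [k.+2 %| r.+1]. [None] contributes y^d. *)
pose w (t : option T) := if t is Some t then e ^+ t.1 * f ^+ t.2 / N else 1.
pose l (t : option T) := if t is Some t
  then lin3 1 (y0 * e ^+ t.1) (f ^+ t.2) else lin3 0 1 0.
have d_gt0 : (0 < d)%N by rewrite /d; lia.
have hl t : l t \is 1.-homog by case: t => [t|]; apply: lin3_homog.
have := weighted_waring_decomp w d_gt0 hl.
rewrite card_option card_prod !card_ord !addn1 !addn2.
suff -> : \sum_t w t *: l t ^+ d = high_rank_form K k by [].
apply/mpolyP => m; rewrite [m]mnm3_eta.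
move: (m ord0) (m (inord 1)) (m (inord 2)) => p q r {m}.
rewrite mcoeffD !mcoeffX !eq_mnm3 (raddf_sum (mcoeff _)) /=.
rewrite (bigD1 None) //= addrC; congr (_ + _); last first.
  rewrite scale1r mcoeff_lin3X -/d.
  have [/and3P[/eqP <- /eqP <- /eqP <-]|nE] :=
    boolP [&& 0 == p, d == q & 0 == r]%N.
    by rewrite add0n addn0 eqxx /trinom addn0 binn bin0 !expr0 expr1n !mulr1.
  case: eqP => // dE; have /orP[h|h] : (p != 0)%N || (r != 0)%N by lia.
    by rewrite [0 ^+ p]expr0n (negPf h) !mul0r mulr0.
  by rewrite [0 ^+ r]expr0n (negPf h) !mulr0.
rewrite (reindex_omap Some id) /=; last by case.
under eq_bigl do rewrite eqxx.
have [dE|dN] := eqVneq (p + q + r)%N d; last first.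
  rewrite big1 => [|t _].
    by rewrite (_ : [&& _, _ & _] = false) //; move: dN; rewrite /d; lia.
  by rewrite mcoeffZ mcoeff_lin3X (negPf dN) mulr0.
have -> : \sum_(t : T) (w (Some t) *: l (Some t) ^+ d)@_(mnm3 p q r) =
  y0 ^+ q * (trinom d q r)%:R / N *
  ((\sum_(i < k.+1) (e ^+ i) ^+ q.+1) * (\sum_(j < k.+2) (f ^+ j) ^+ r.+1)).
  rewrite big_distrlr pair_big mulr_sumr; apply: eq_bigr => t _.
  rewrite mcoeffZ mcoeff_lin3X dE eqxx expr1n exprMn !exprS /w /=.
  by move: (N^-1) (e ^+ t.1) (f ^+ t.2) => N' u v; ring.
rewrite (sum_prim_rootX _ pe) (sum_prim_rootX _ pf).
have [/and3P[_ /eqP Eq /eqP Er]|nE] :=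
  boolP [&& 1 == p, k == q & k.+1 == r]%N.
  rewrite -Eq -Er !dvdnn.
  (* For [k = 0] this reads [0 ^+ 0 = 1]. *)
  have -> : y0 ^+ k = 1 by rewrite /y0; case: (k) => //= n; rewrite expr1n.
  by rewrite mul1r mulrAC mulrA -/N divff.
have [r1|_] := boolP (k.+2 %| r.+1)%N; last by rewrite !mulr0.
have [q1|_] := boolP (k.+1 %| q.+1)%N; last by rewrite mul0r mulr0.
(* Degree [d] forces [r = k + 1], then [q = k] (the target) unless [k = 0] and [q = 1]: the monomial
   y z, killed by [y0]. *)
case/dvdnP: r1 => r' r'E; case/dvdnP: q1 => q' q'E.
suff -> : y0 ^+ q = 0 by rewrite !mul0r.
have r'1 : r' = 1%N by rewrite /d in dE; nia.
rewrite r'1 mul1n in r'E; case: r'E => r'E.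
have qE : (p + q = k.+1)%N by rewrite /d in dE; lia.
suff [k0 q0] : k = 0%N /\ q != 0%N by rewrite /y0 k0 /= expr0n (negPf q0).
have [k0|k0] := eqVneq k 0%N.
  split=> //; move: nE; rewrite r'E eqxx andbT k0; lia.
have q'1 : q' = 1%N by nia.
move: nE; rewrite r'E eqxx andbT; lia.
Qed.

Theorem proposition2 (K : closedFieldType) (charK0 : [pchar K] =i pred0)
    (k : nat) :
  exists (F : {mpoly K[3]}) (r : nat),
    F \is (2 * k + 2).-homog /\
    is_waring_rank (2 * k + 2) F r /\
    (k ^ 2 + 3 * k + 2 < r)%N.
Proof.
exists (high_rank_form K k), ((k + 1) * (k + 2)).+1; split.
  exact: high_rank_form_homog.
split; last by rewrite ltnS -mulnn; lia.
split; first exact: waring_decomp_high_rank_form.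
by move=> s; apply: waring_decomp_high_rank_form_ge.
Qed.
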